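(* Let $1\le q<p\le\infty$, $\beta:=1/q-1/p$, and let $C(p,q)>0$ be a constant. Then there exists a constant $C'(p,q)>0$, depending only on $p$, $q$ and $C(p,q)$, with the following property. Let $\Omega$ be a compact space with a normalized measure $\mu$, let $m>0$, and let $f$ be a continuous function on $\Omega$ satisfying the Nikol'skii inequality $$\|f\|_p\le C(p,q)\,m^{\beta}\,\|f\|_q .$$ Then for every measurable set $B\subset\Omega$ with $|B|\le (C'(p,q)\,m)^{-1}$, $$\|f\|_{L_q(\Omega)}\le 2\,\|f\|_{L_q(\Omega\setminus B)}.$$
   Context: $\mu$ is a Borel measure on $\Omega$ with $\mu(\Omega)=1$, and $|B|=\mu(B)$. For $0<p<\infty$ and measurable $E\subset\Omega$, $\|f\|_{L_p(E)}=\big(\int_E|f|^p\,d\mu\big)^{1/p}$; $\|f\|_{L_\infty(E)}$ is the essential supremum of $|f|$ over $E$; $\|f\|_p=\|f\|_{L_p(\Omega)}$. Convention: $1/\infty=0$. *)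

(* Defs.v *)
From HB Require Import structures.
From mathcomp Require Import all_boot all_order all_algebra.
From mathcomp Require Import all_classical all_reals all_analysis.

Set Implicit Arguments.
Unset Strict Implicit.
Unset Printing Implicit Defensive.

Import Order.TTheory GRing.Theory Num.Theory.
Import numFieldNormedType.Exports.

Local Open Scope classical_set_scope.
Local Open Scope ring_scope.
Local Open Scope ereal_scope.

(* [borel T] is convertible to [T]. *)
Notation borel T := (g_sigma_algebraType (@open T)).

(* Functions take values in an arbitrary real normed space, so that both real-
   and complex-valued functions are covered: only [`|f x|] is used. *)
Section Lp_norms.
Context d (T : measurableType d) (R : realType) (V : normedModType R).
Variable mu : {measure set T -> \bar R}.

Definition Lp_norm (p : \bar R) (f : T -> V) : \bar R :=
  'N[mu]_p[(fun x => `|f x|%:E)].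

Definition Lq_norm_on (E : set T) (q : R) (f : T -> V) : \bar R :=
  (\int[mu]_(x in E) (`|f x| `^ q)%:E) `^ q^-1.

End Lp_norms.

(* Main.v *)
(* With beta = 1/q - 1/p, Hoelder gives
   ||f||_{L_q(B)} <= ||f||_p |B|^beta <= C (m |B|)^beta ||f||_q, so
   C' = (2 C)^(1 / beta) makes the last factor at most 1/2.  Minkowski is not
   needed to conclude: splitting the integral of |f|^q over B and its complement
   yields (1 - 2^-q) ||f||_q^q <= ||f||_{L_q(~B)}^q, provided ||f||_q is finite
   (f is bounded, by compactness), and 1 - 2^-q >= 2^-q because q >= 1. *)
Require Import Defs.
From HB Require Import structures.
From mathcomp Require Import all_boot all_order all_algebra.
From mathcomp Require Import all_classical all_reals all_analysis.
From mathcomp Require Import measurable_realfun ess_sup_inf ring lra.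

Import Order.TTheory GRing.Theory Num.Theory.
Import numFieldNormedType.Exports.

Local Open Scope classical_set_scope.
Local Open Scope ring_scope.
Local Open Scope ereal_scope.

Lemma continuous_borel_measurable (R : realType) (T : ptopologicalType)
    (g : T -> R) :
  continuous g -> measurable_fun [set: borel T] g.
Proof.
move=> cg; apply: (measurability _ (RGenOpens.measurableE R)).
move=> _ [_ [a [b ->]] <-]; rewrite setTI.
apply: sub_sigma_algebra; apply: open_comp; last exact: interval_open.
by move=> x _; exact: cg.
Qed.

(** This makes the exponent [beta] positive; for [p = +oo] the extended inverse is 0, matching the
    convention $1/\infty=0$. *)
Lemma fine_inve_lt (R : realType) (q : R) (p : \bar R) :
  (0 < q)%R -> q%:E < p -> (fine (p^-1)%E < q^-1)%R.
Proof.
move=> q0; case: p => [p| |] //; last by rewrite invey/= invr_gt0.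
rewrite lte_fin => qp; have p0 := lt_trans q0 qp.
by rewrite inver gt_eqF//= ltf_pV2.
Qed.

Lemma le_poweR (R : realType) (r : R) (x y : \bar R) :
  (0 <= r)%R -> 0 <= x -> x <= y -> x `^ r <= y `^ r.
Proof.
move=> r0 x0 xy; apply: gt0_ler_poweR => //; rewrite in_itv/= leey andbT//.
exact: le_trans xy.
Qed.

(** For finite [p], Hoelder applied to $g^q\cdot 1_B$ with exponents $p/q$ and its conjugate; for
    [p = +oo], the integrand is bounded almost everywhere by the [q]-th power of the essential
    supremum. The [q]-th power form lets the integral over [B] be subtracted directly from the whole
    one. *)
Lemma integral_powR_le_Lnorm (d : measure_display) (T : measurableType d)
    (R : realType) (mu : {measure set T -> \bar R}) (q : R)
    (p : \bar R) (g : T -> R) (B : set T) :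
  (0 < q)%R -> q%:E < p -> (forall x, 0 <= g x)%R ->
  measurable_fun [set: T] g -> measurable B ->
  \int[mu]_(x in B) (g x `^ q)%:E <=
    ('N[mu]_p[EFin \o g] * mu B `^ (q^-1 - fine (p^-1)%E)) `^ q.
Proof.
move=> q0 qp g0 mg mB.
have mgq : measurable_fun [set: T] (fun x => (g x `^ q)%R).
  exact: (@measurableT_comp _ _ _ _ _ _ (@powR R ^~ q)).
have mgqB : measurable_fun B (fun x => (g x `^ q)%:E).
  by apply: measurable_funTS; exact/measurable_EFinP.
rewrite poweRM ?Lnorm_ge0 ?poweR_ge0// -poweRrM.
case: p qp => [p| |] //; last first.
  move=> _; rewrite invey/= subr0 mulVf ?gt_eqF// poweRe1//.
  (* The norm at [+oo] is the essential supremum only on a space of positive measure, and 0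
     otherwise; in the null case both sides vanish. *)
  have [muT|] := ltP 0 (mu [set: T]); last first.
    move=> muT0; have muB : mu B = 0.
      apply/eqP; rewrite eq_le measure_ge0 andbT.
      by apply: le_trans muT0; apply: le_measure => //; rewrite inE.
    rewrite muB mule0 null_set_integral//.
  rewrite unlock muT -integral_cst//.
  apply: ae_ge0_le_integral => //.
  - by move=> x _; rewrite lee_fin powR_ge0.
  - by move=> x _; exact: poweR_ge0.
  - apply: filterS (ess_sup_ge mu (abse \o (EFin \o g))) => x gx _.
    rewrite -poweR_EFin; apply: le_poweR; [exact: ltW|by rewrite lee_fin|].
    by apply: le_trans gx; rewrite /= ger0_norm.
rewrite lte_fin => qp.
have p0 : (0 < p)%R by exact: lt_trans qp.
have pq1 : (1 < p / q)%R by rewrite ltr_pdivlMr// mul1r.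
(* [s^-1] is the Hoelder conjugate of [p / q], and [s] is [q] times the exponent of [mu B] in the
   statement. *)
set s : R := (1 - q / p)%R.
have s0 : (0 < s)%R by rewrite subr_gt0 ltr_pdivrMr// mul1r.
have -> : ((q^-1 - fine p%:E^-1%E) * q = s)%R.
  by rewrite inver gt_eqF//= mulrBl mulVf ?gt_eqF// mulrC.
have := @hoelder _ _ _ mu (fun x => (g x `^ q)%R) \1_B (p / q) s^-1 mgq
  (measurable_indic mB) (divr_gt0 p0 q0) _ _.
rewrite invr_gt0 => /(_ s0); rewrite invrK invf_div /s addrC subrK => /(_ erefl).
rewrite -/s Lnorm1.
have -> : \int[mu]_x `|(EFin \o ((fun x => (g x `^ q)%R) \* \1_B)%R) x| =
    \int[mu]_(x in B) (g x `^ q)%:E.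
  rewrite [RHS]integral_mkcond epatch_indic; apply: eq_integral => x _ /=.
  by rewrite ger0_norm ?EFinM// mulr_ge0 ?powR_ge0.
move/le_trans; apply.
have -> : 'N[mu]_((p / q)%:E)[EFin \o (fun x => (g x `^ q)%R)] =
    'N[mu]_p%:E[EFin \o g] `^ q.
  rewrite unlock -poweRrM invf_div [(p^-1 * q)%R]mulrC; congr (_ `^ _).
  apply: eq_integral => x _ /=; rewrite !ger0_norm ?powR_ge0//.
  by rewrite -powRrM mulrCA mulfV ?gt_eqF// mulr1.
suff -> : 'N[mu]_(s^-1)%:E[EFin \o \1_B] = mu B `^ s by [].
rewrite unlock invrK; congr (_ `^ _).
rewrite -(setIT B) -integral_indic// setIT; apply: eq_integral => x _ /=.
rewrite indicE; case: (_ \in _); rewrite ?normr1 ?powR1// normr0.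
by rewrite powR0// invr_eq0 gt_eqF.
Qed.

Theorem proposition2p3 (R : realType) (q : R) (p : \bar R) (C : R)
    (hq : (1 <= q)%R) (hqp : q%:E < p) (hC : (0 < C)%R) :
  let beta := (q^-1 - fine (p^-1)%E)%R in
  exists C' : R, (0 < C')%R /\
    forall (T : ptopologicalType) (mu : probability (borel T) R)
      (m : R) (V : normedModType R) (f : T -> V),
      compact [set: T] -> (0 < m)%R -> continuous f ->
      Lp_norm mu p f <= (C * m `^ beta)%:E * Lp_norm mu q%:E f ->
      forall B : set (borel T), measurable B -> mu B <= ((C' * m)^-1)%:E ->
        Lp_norm mu q%:E f <= 2%:E * Lq_norm_on mu (~` B) q f.
Proof.
move=> beta.
have q0 : (0 < q)%R by exact: lt_le_trans hq.
have beta0 : (0 < beta)%R.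
  by rewrite subr_gt0; exact: fine_inve_lt.
have C2 : (0 < 2 * C)%R by rewrite mulr_gt0.
exists ((2 * C) `^ beta^-1)%R; split; first exact: powR_gt0.
set C' := (_ `^ _)%R; have C'0 : (0 < C')%R by exact: powR_gt0.
have C'b : (C' `^ beta = 2 * C)%R.
  by rewrite -powRrM mulVf ?gt_eqF// powRr1// ltW.
move=> T mu m V f cT m0 cf hf B mB muB.
pose g : borel T -> R := fun x => (`|f x|)%R.
have g0 x : (0 <= g x)%R by exact: normr_ge0.
have mg : measurable_fun [set: borel T] g.
  apply: continuous_borel_measurable => x.
  exact: (continuous_comp (cf x) (@norm_continuous _ _ _)).
have mgq D : measurable_fun D (fun x => (g x `^ q)%:E).
  apply: measurable_funTS; apply/measurable_EFinP.
  exact: (@measurableT_comp _ _ _ _ _ _ (@powR R ^~ q)).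
have I0 (D : set (borel T)) : 0 <= \int[mu]_(x in D) (g x `^ q)%:E.
  by apply: integral_ge0 => x _; rewrite lee_fin powR_ge0.
set I := \int[mu]_(x in [set: borel T]) (g x `^ q)%:E.
have NE : Lp_norm mu q%:E f = I `^ q^-1.
  rewrite /Lp_norm unlock; congr (_ `^ _); apply: eq_integral => x _.
  by rewrite /= normr_id.
have Ioo : I < +oo.
  have [M [_ Mf]] := compact_bounded
    (continuous_compact (continuous_subspaceT cf) cT).
  (* Boundedness gives a bound by every number strictly above [M], hence [M + 1]; the maximum with 0
     makes [K] visibly nonnegative, as monotonicity of the power requires. *)
  pose K := Num.max 0%R (M + 1)%R.
  have K0 : (0 <= K)%R by rewrite le_max lexx.
  have gK x : (g x <= K)%R.
    apply: (@le_trans _ _ (M + 1)%R); last by rewrite le_max lexx orbT.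
    by apply: Mf; [rewrite ltrDl|exists x].
  apply: (@le_lt_trans _ _ (\int[mu]_(x in [set: borel T]) cst (K `^ q)%:E x)).
    apply: ge0_le_integral => //.
    - by move=> x _; rewrite lee_fin powR_ge0.
    - by move=> x _; rewrite lee_fin ge0_ler_powR ?nnegrE// ltW.
  by rewrite integral_cst// [X in _ * X](probability_setT mu) mule1 ltry.
have split : I = \int[mu]_(x in B) (g x `^ q)%:E
               + \int[mu]_(x in ~` B) (g x `^ q)%:E.
  rewrite -(ge0_integral_setU mu mB (measurableC mB)) ?setUv//.
    by move=> x _; rewrite lee_fin powR_ge0.
  exact/disj_setPCl.
set J := \int[mu]_(x in ~` B) _ in split *.
have IB : \int[mu]_(x in B) (g x `^ q)%:E <= (2^-1 `^ q)%:E * I.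
  apply: le_trans (@integral_powR_le_Lnorm _ _ _ mu q p g B q0 hqp g0 mg mB) _.
  (* The factor 1/2 is obtained at the level of norms, under the power [q], where the Nikol'skii
     hypothesis applies. *)
  apply: (@le_trans _ _ ((2^-1%:E * Lp_norm mu q%:E f) `^ q)); last first.
    rewrite NE poweRM ?poweR_ge0// poweR_EFin -poweRrM mulVf ?gt_eqF//.
    by rewrite poweRe1// I0.
  apply: le_poweR; first exact: ltW.
    by rewrite mule_ge0 ?Lnorm_ge0 ?poweR_ge0.
  have muBb : mu B `^ beta <= ((C' * m)^-1 `^ beta)%:E.
    by rewrite -poweR_EFin; apply: le_poweR => //; exact: ltW.
  apply: le_trans (lee_pmul _ _ hf muBb) _; rewrite ?Lnorm_ge0 ?poweR_ge0//.
  rewrite muleAC lee_wpmul2r ?Lnorm_ge0// -EFinM lee_fin.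
  (* Here $(C'm)^{-\beta}=(2Cm^\beta)^{-1}$, so $Cm^\beta$ cancels and exactly 1/2 remains. *)
  rewrite -(powR_inv1 (mulr_ge0 (ltW C'0) (ltW m0))) powRAC powR_inv1 ?powR_ge0//.
  rewrite (powRM _ (ltW C'0) (ltW m0)) C'b le_eqVlt; apply/orP; left; apply/eqP; field.
  by rewrite !gt_eqF ?powR_gt0.
have Ifin : I \is a fin_num by rewrite ge0_fin_numE ?I0.
have Jfin : J \is a fin_num.
  rewrite ge0_fin_numE ?I0//; apply: le_lt_trans Ioo; rewrite split.
  by rewrite leeDr.
have IJ : I <= (2 `^ q)%:E * J.
  have half : (2^-1 `^ q <= 2^-1 :> R)%R.
    by rewrite ge1r_powR// invr_gt0 invf_le1// ltr0n ler1n.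
  have h0 : (0 < 2^-1 `^ q :> R)%R by rewrite powR_gt0// invr_gt0.
  have -> : (2 `^ q = (2^-1 `^ q)^-1 :> R)%R.
    by rewrite -powRN -[in RHS](powR_inv1 (ler0n _ 2)) -powRrM mulN1r opprK.
  have bfin : \int[mu]_(x in B) (g x `^ q)%:E \is a fin_num.
    by move: Ifin; rewrite split fin_numD => /andP[].
  move: (I0 [set: borel T]) IB split; rewrite -/I.
  rewrite -(fineK Ifin) -(fineK Jfin) -(fineK bfin).
  rewrite -!EFinM -EFinD !lee_fin => i0 ib [ibj].
  (* With $h=2^{-q}\le 1/2$ and $b$ the integral over [B], $J=I-b\ge(1-h)I\ge hI$; the last
     inequality is the product of $1-2h\ge 0$ and $I\ge 0$. *)
  rewrite mulrC ler_pdivlMr//; nra.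
rewrite NE (le_trans (@le_poweR _ q^-1 _ _ _ (I0 _) IJ)) ?invr_ge0 ?(ltW q0)//.
rewrite poweRM ?lee_fin ?powR_ge0 ?I0// poweR_EFin -powRrM mulfV ?gt_eqF//.
by rewrite powRr1.
Qed.
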